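(* Let $E$ be a finite set, $f:2^E\to\mathbb{R}$ a polymatroid function, and $g(U):=f(E)-f(E\setminus U)$ for $U\subseteq E$. Let $c$ be a constant with $c\ge f(E)$, let $\mathbf{c}\in\mathbb{R}^E$ be the vector all of whose entries equal $c$, and let $$Q_{g,c}=\{x\in\mathbb{R}^E: \mathbf{c}\ge x,\ x(A)\ge g(A)\ \forall A\subseteq E\}.$$ Let $t:\mathbb{R}^E\to\mathbb{R}^E$ be the map $t(x)=-x+\mathbf{c}$. Then $t(Q_{g,c})$ is a polymatroid.
   Context: For $x\in\mathbb{R}^E$ and $A\subseteq E$ write $x(A)=\sum_{e\in A}x(e)$; inequalities between vectors are componentwise. A polymatroid function is a function $f:2^E\to\mathbb{R}$ with $f(\emptyset)=0$, $f(A)\le f(B)$ whenever $A\subseteq B\subseteq E$, and $f(A\cap B)+f(A\cup B)\le f(A)+f(B)$ for all $A,B\subseteq E$. A set $P\subseteq\mathbb{R}^E$ is called a polymatroid if $P$ is a compact nonempty subset of $\mathbb{R}^E_{\ge 0}$ such that: (i) if $0\le x\le y$ and $y\in P$ then $x\in P$; (ii) for any $x\in\mathbb{R}^E_{\ge 0}$, all vectors $y$ that are maximal (componentwise) among the vectors $y\in P$ with $y\le x$ have the same component sum $y(E)$. *)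

(* Defs.v *)
From mathcomp Require Import all_boot all_order all_algebra.
From mathcomp Require Import all_classical all_reals topology.
From mathcomp Require Import normedtype.

Set Implicit Arguments.
Unset Strict Implicit.
Unset Printing Implicit Defensive.

Import Order.TTheory GRing.Theory Num.Theory.
Import numFieldNormedType.Exports.

Local Open Scope classical_set_scope.
Local Open Scope ring_scope.

(* Vectors of R^E are functions [E -> R].  [(x <= y)%O] is the library's
   pointwise order on functions (see [lefP]), and [- x], [x + y] are the
   pointwise operations.  The name [set0] is shadowed by that of [classical_sets],
   hence [finset.set0] for the finite empty set. *)

Section Polymatroids.
Variables (R : realType) (E : finType).

Definition vsum (x : E -> R) (A : {set E}) : R := \sum_(e in A) x e.

Definition polymatroid_function (f : {set E} -> R) : Prop :=
  [/\ f finset.set0 = 0,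
      (forall A B : {set E}, A \subset B -> f A <= f B)
    & (forall A B : {set E}, f (A :&: B) + f (A :|: B) <= f A + f B)].

Definition maximal_below (P : set (E -> R)) (x y : E -> R) : Prop :=
  [/\ P y, (y <= x)%O
    & forall z : E -> R, P z -> (z <= x)%O -> (y <= z)%O -> z = y].

(* Since [E] is finite, the product topology [{ptws E -> R}] is the Euclidean
   topology. *)
Definition polymatroid (P : set (E -> R)) : Prop :=
  [/\ compact (P : set {ptws E -> R}),
      P !=set0,
      P `<=` [set x : E -> R | (cst 0 <= x)%O],
      (forall x y : E -> R, (cst 0 <= x)%O -> (x <= y)%O -> P y -> P x)
    & (forall x : E -> R, (cst 0 <= x)%O ->
        forall y z : E -> R, maximal_below P x y -> maximal_below P x z ->
          vsum y [set: E]%SET = vsum z [set: E]%SET)].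

Definition dual_function (f : {set E} -> R) (U : {set E}) : R :=
  f [set: E]%SET - f ([set: E]%SET :\: U).

Definition Qgc (g : {set E} -> R) (c : R) : set (E -> R) :=
  [set x : E -> R | (x <= cst c)%O /\ forall A : {set E}, g A <= vsum x A].

Definition reflection (c : R) (x : E -> R) : E -> R := - x + cst c.

End Polymatroids.

(* Main.v *)
Require Import Defs.
From mathcomp Require Import all_boot all_order all_algebra.
From mathcomp Require Import all_classical all_reals topology.
From mathcomp Require Import normedtype.
From mathcomp Require Import lra.

Import Order.TTheory GRing.Theory Num.Theory.
Import numFieldNormedType.Exports.

Local Open Scope classical_set_scope.
Local Open Scope ring_scope.

(** Substituting [y = c - x] turns the upper bounds [x <= c] into [0 <= y] and
    the lower bounds [g A <= x(A)] into upper bounds [y(A) <= h A], where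
    [h A = c |A| - g A = c |A| - f(E) + f(E \ A)].  So the reflected polyhedron
    is [independence_polytope h], and it is enough to know three things about
    [h]: it vanishes on the empty set, it is nonnegative (for nonempty [A] this
    is where [f(E) <= c] enters, through [f(E) <= c <= c |A|]), and it is
    submodular, because complementation exchanges unions and intersections and
    [A |-> c |A| - f(E)] is modular.

    For every such [h] the polytope is a polymatroid.  It is compact, as a
    closed subset of the box with sides [0, h {e}].  For the equality of the
    sums of maximal vectors, call a set [A] tight for [y] when [y(A) = h A].
    Submodularity makes tight sets stable under union, and the empty set is
    tight since [h] vanishes there, so there is a largest one, [T].  If [y] is
    maximal below [x], each coordinate with [y e < x e] lies in a tight set, as
    otherwise it could be raised; hence [y] agrees with [x] outside [T], and
    [y(E) = h T + x(E \ T)].  The right-hand side bounds [z(E)] for every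
    member [z <= x] of the polytope, so a maximal vector has the largest
    possible sum, and two maximal vectors have the same sum. *)

Section CoordinateSums.
Context {R : realType} {E : finType}.
Implicit Types (x y : E -> R) (A B : {set E}).

Lemma vsum_set1 x (e : E) : vsum x [set e]%SET = x e.
Proof. exact: big_set1. Qed.

Lemma le_vsum x y A : (x <= y)%O -> vsum x A <= vsum y A.
Proof. by move=> /lefP xy; apply: ler_sum. Qed.

Lemma vsumID x A B : vsum x A = vsum x (A :&: B) + vsum x (A :\: B).
Proof. exact: big_setID. Qed.

Lemma vsum_modular x A B :
  vsum x (A :&: B) + vsum x (A :|: B) = vsum x A + vsum x B.
Proof.
rewrite (vsumID x (A :|: B) B) (vsumID x A B).
rewrite finset.setIUl finset.setIid (finset.setUidPr (finset.subsetIr A B)).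
by rewrite finset.setDUl finset.setDv finset.setU0; lra.
Qed.

Lemma vsum_reflection c x A : vsum (reflection c x) A = c *+ #|A| - vsum x A.
Proof.
rewrite /vsum /reflection big_split /= sumrN addrC; congr (_ - _).
exact: sumr_const.
Qed.

Lemma vsum_raise x (e : E) (t : R) A :
  vsum (fun i => x i + (if i == e then t else 0)) A =
  vsum x A + (if e \in A then t else 0).
Proof.
rewrite /vsum big_split /=; congr (_ + _); case: ifPn => eA.
  by rewrite (bigD1 e) //= eqxx big1 ?addr0 // => i /andP[_ /negPf->].
by rewrite big1 // => i iA; case: eqP => // ie; rewrite -ie iA in eA.
Qed.

Lemma vsum_continuous A : continuous ((vsum (E:=E))^~ A : {ptws E -> R} -> R).
Proof.
have -> : (vsum (E:=E))^~ A =
    \sum_(e in A) (fun x : {ptws E -> R} => x e) :> (_ -> R).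
  by apply/funext => x; rewrite /vsum fct_sumE.
elim/big_ind: _ => [x|F G cF cG x|e _].
- exact: (@cst_continuous {ptws E -> R} R 0).
- exact: (cvgD (cF x) (cG x)).
- exact: (@proj_continuous E (fun=> R) e).
Qed.

End CoordinateSums.

Section IndependencePolytope.
Context {R : realType} {E : finType}.
Variable h : {set E} -> R.
Implicit Types (x y z : E -> R) (A B : {set E}).

Definition independence_polytope : set (E -> R) :=
  [set y | (cst 0 <= y)%O /\ forall A, vsum y A <= h A].

Lemma compact_independence_polytope :
  compact (independence_polytope : set {ptws E -> R}).
Proof.
pose box := [set y : {ptws E -> R} |
  forall e, `[0, h [set e]%SET]%classic (y e)].
have box_compact : compact box.
  exact: (@tychonoff E (fun=> R) _
    (fun e => @segment_compact R 0 (h [set e]%SET))).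
apply: (subclosed_compact _ box_compact) => [|y [/lefP y0 yh] e]; last first.
  by rewrite /= in_itv /= y0 -vsum_set1 yh.
have -> : independence_polytope =
    (\bigcap_(e in [set: E])
      ((fun y : {ptws E -> R} => y e) @^-1` [set t | 0 <= t])) `&`
    (\bigcap_(A in [set: {set E}])
      ((vsum (E:=E))^~ A : {ptws E -> R} -> R) @^-1` [set t | t <= h A]).
  apply/seteqP; split => [y [/lefP y0 yh]|y [y0 yh]].
    by split=> [e|A] _; [exact: y0|exact: yh].
  by split=> [|A]; [apply/lefP => e; exact: y0|exact: yh].
apply: closedI; apply: closed_bigI => i _; apply: preimage_closed.
- by move=> y _; exact: (@proj_continuous E (fun=> R) i).
- exact: closed_ge.
- by move=> y _; exact: vsum_continuous.
- exact: closed_le.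
Qed.

Lemma independence_polytope_down x y :
  (cst 0 <= x)%O -> (x <= y)%O ->
  independence_polytope y -> independence_polytope x.
Proof.
by move=> x0 xy [_ yh]; split=> // A; apply: le_trans (yh A); exact: le_vsum.
Qed.

(** A slack coordinate that meets no tight set could be raised by the least of
    the finitely many slacks that it affects. *)
Lemma maximal_below_tight x y (e : E) :
  maximal_below independence_polytope x y -> y e < x e ->
  exists2 A : {set E}, e \in A & vsum y A = h A.
Proof.
move=> [[/lefP y0 yh] /lefP yx ymax] ye.
apply: contrapT => notight.
have slack A : e \in A -> 0 < h A - vsum y A.
  move=> eA; rewrite subr_gt0 lt_neqAle yh andbT.
  by apply/eqP => yA; apply: notight; exists A.
pose t := \big[Num.min/x e - y e]_(A : {set E} | e \in A) (h A - vsum y A).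
have t0 : 0 < t by apply: lt_bigmin; rewrite ?subr_gt0.
pose z i := y i + (if i == e then t else 0).
have yz : (y <= z)%O.
  by apply/lefP => i; rewrite /z lerDl; case: ifP => // _; exact: ltW.
have zP : independence_polytope z.
  split=> [|A]; first by apply: le_trans yz; apply/lefP.
  rewrite vsum_raise; case: ifPn => eA; last by rewrite addr0.
  by rewrite addrC -lerBrDr; exact: bigmin_le_cond.
have zx : (z <= x)%O.
  apply/lefP => i; rewrite /z; case: eqP => [->|_]; last by rewrite addr0.
  by rewrite addrC -lerBrDr; exact: bigmin_le_id.
have /(congr1 (fun u => u e)) := ymax z zP zx yz.
by rewrite /z eqxx; lra.
Qed.

Hypothesis h_set0 : h finset.set0 = 0.
Hypothesis h_submod :
  forall A B : {set E}, h (A :&: B) + h (A :|: B) <= h A + h B.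

Lemma tightU y A B : independence_polytope y ->
  vsum y A = h A -> vsum y B = h B -> vsum y (A :|: B) = h (A :|: B).
Proof.
move=> [_ yh] yA yB; apply/eqP; rewrite eq_le yh /=.
have := h_submod A B; have := vsum_modular y A B; have := yh (A :&: B).
by rewrite yA yB; lra.
Qed.

(** A maximal vector certifies its own optimality: its largest tight set [T]
    contains all its slack coordinates, so that [y(E) = h T + x(E \ T)], which
    bounds the sum of every competitor. *)
Lemma maximal_below_vsum_max x y z :
  maximal_below independence_polytope x y ->
  independence_polytope z -> (z <= x)%O ->
  vsum z [set: E]%SET <= vsum y [set: E]%SET.
Proof.
move=> ymax [_ zh] zx; have [yP /lefP yx _] := ymax.
pose T := (\bigcup_(A : {set E} | vsum y A == h A) A)%SET.
have yT : vsum y T = h T.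
  rewrite /T; elim/big_ind: _ => [|A B yA yB|A /eqP //].
    by rewrite h_set0 /vsum finset.big_set0.
  exact: tightU.
have yCT : vsum x (~: T) = vsum y (~: T).
  apply: eq_bigr => e; rewrite finset.in_setC => eT; apply/eqP.
  rewrite eq_le yx andbT leNgt; apply: contra eT => ye.
  have [A eA yA] := maximal_below_tight _ _ _ ymax ye.
  by apply/finset.bigcupP; exists A => //; apply/eqP.
rewrite (vsumID z _ T) (vsumID y _ T) finset.setTI finset.setTD yT -yCT.
by apply: lerD; [exact: zh|exact: le_vsum].
Qed.

(** Nonnegativity of [h] puts the origin in the polytope. *)
Lemma polymatroid_independence_polytope :
  (forall A, 0 <= h A) -> polymatroid independence_polytope.
Proof.
move=> h0; split.
- exact: compact_independence_polytope.
- by exists (cst 0); split=> // A; rewrite /vsum big1.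
- by move=> y [].
- exact: independence_polytope_down.
- move=> x _ y z ymax zmax; have [yP yx _] := ymax; have [zP zx _] := zmax.
  by apply/eqP; rewrite eq_le !(maximal_below_vsum_max x).
Qed.

End IndependencePolytope.

Section Reflection.
Context {R : realType} {E : finType}.
Implicit Types (f g : {set E} -> R) (c : R) (A B : {set E}).

Lemma reflectionK c : involutive (reflection (E:=E) c).
Proof. by move=> x; apply/funext => e; rewrite /reflection !fctE /=; lra. Qed.

Lemma reflection_Qgc g c :
  reflection c @` Qgc g c = independence_polytope (fun A => c *+ #|A| - g A).
Proof.
apply/seteqP; split => [_ [x [/lefP xc gx] <-]|y [/lefP y0 yg]].
  split=> [|A]; last by rewrite vsum_reflection lerD2l lerN2.
  by apply/lefP => e; have := xc e; rewrite /reflection !fctE /=; lra.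
exists (reflection c y); last exact: reflectionK.
split=> [|A]; last by rewrite vsum_reflection; have := yg A; lra.
by apply/lefP => e; have := y0 e; rewrite /reflection !fctE /=; lra.
Qed.

Lemma reflected_bound_submodular f c :
  polymatroid_function f -> forall A B,
  (c *+ #|A :&: B| - dual_function f (A :&: B)) +
  (c *+ #|A :|: B| - dual_function f (A :|: B)) <=
  (c *+ #|A| - dual_function f A) + (c *+ #|B| - dual_function f B).
Proof.
move=> [_ _ fsub] A B; rewrite /dual_function.
have := fsub ([set: E] :\: A)%SET ([set: E] :\: B)%SET.
rewrite -finset.setDUr -finset.setDIr.
have : c *+ #|A :&: B| + c *+ #|A :|: B| = c *+ #|A| + c *+ #|B|.
  by rewrite -!mulrnDr addnC cardsUI.
by lra.
Qed.

Lemma reflected_bound_ge0 f c :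
  polymatroid_function f -> f [set: E]%SET <= c ->
  forall A, 0 <= c *+ #|A| - dual_function f A.
Proof.
move=> [f0 fmono _] fc A; rewrite /dual_function.
have f_ge0 B : 0 <= f B by rewrite -f0 fmono // finset.sub0set.
have c0 : 0 <= c := le_trans (f_ge0 _) fc.
have [->|A0] := eqVneq A finset.set0.
  by rewrite cards0 finset.setD0; lra.
have : c <= c *+ #|A|.
  by case: #|A| (card_gt0 A) => [|n _]; rewrite ?A0 // mulrS lerDl mulrn_wge0.
by have := f_ge0 ([set: E] :\: A)%SET; lra.
Qed.

End Reflection.

Theorem theorem3p10 (R : realType) (E : finType) (f : {set E} -> R) (c : R)
    (polyf : polymatroid_function f) (fE_le_c : f [set: E]%SET <= c) :
  polymatroid (reflection c @` Qgc (dual_function f) c).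
Proof.
rewrite reflection_Qgc; apply: polymatroid_independence_polytope.
- by rewrite /dual_function cards0 finset.setD0 subrr subr0.
- exact: reflected_bound_submodular.
- exact: reflected_bound_ge0.
Qed.
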